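(* Let $H$ and $K$ be Hilbert $\mathfrak{A}$-modules over a $C^*$-algebra $\mathfrak{A}$, let $M\in\mathcal{L}(K)$ and $N\in\mathcal{L}(H)$ be weights, and let $A\in\mathcal{L}(H,K)$ be such that $A^\dag_{MN}$ exists. If $\{M_n\}_{n\in\mathbb{N}}\subseteq\mathcal{L}(K)$ and $\{N_n\}_{n\in\mathbb{N}}\subseteq\mathcal{L}(H)$ are sequences of self-adjoint operators satisfying $$\lim_{n\to\infty}\|M_n-M\|=0,\qquad \lim_{n\to\infty}\|N_n-N\|=0,$$ then there exists $n_0\in\mathbb{N}$ such that $A^\dag_{M_nN_n}$ exists for all $n\ge n_0$. Moreover, $$\lim_{n\to\infty}\|A^\dag_{M_nN_n}-A^\dag_{MN}\|=0.$$
   Context: $\mathcal{L}(H,K)$ is the set of adjointable operators from $H$ to $K$, $\mathcal{L}(H)=\mathcal{L}(H,H)$. A weight on $K$ is an operator $M\in\mathcal{L}(K)$ with $M=M^*$ that is invertible in $\mathcal{L}(K)$ (it need not be positive). For weights $M\in\mathcal{L}(K)$, $N\in\mathcal{L}(H)$ and $A\in\mathcal{L}(H,K)$, the weighted Moore-Penrose inverse $A^\dag_{MN}$ (if it exists) is the (necessarily unique) element $X\in\mathcal{L}(K,H)$ satisfying $AXA=A$, $XAX=X$, $(MAX)^*=MAX$, $(NXA)^*=NXA$. Since $A^\dag_{MN}$ is defined only for weights, asserting that $A^\dag_{M_nN_n}$ exists includes asserting that $M_n$ and $N_n$ are weights (i.e. invertible). *)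

(* Defs.v *)
From HB Require Import structures.
From mathcomp Require Import all_boot all_order all_algebra.
From mathcomp Require Export complex.
From mathcomp Require Import all_classical all_reals all_analysis.

Set Implicit Arguments.
Unset Strict Implicit.
Unset Printing Implicit Defensive.

Import Order.TTheory GRing.Theory Num.Theory.
Import numFieldNormedType.Exports.

Local Open Scope classical_set_scope.
Local Open Scope ring_scope.
Local Open Scope complex_scope.

(* C*-algebras are not assumed to be unital, so the product cannot come from
   the (unital) rings of the algebraic hierarchy. *)
HB.mixin Record CompleteNormedModule_isCstarAlgebra (R : realType) (A : Type)
    of CompleteNormedModule R[i] A := {
  cmul : A -> A -> A;
  cstar : A -> A;
  cmulA : associative cmul;
  cmulDl : left_distributive cmul +%R;
  cmulDr : right_distributive cmul +%R;
  cmulZl : forall (k : R[i]) a b, cmul (k *: a) b = k *: cmul a b;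
  cmulZr : forall (k : R[i]) a b, cmul a (k *: b) = k *: cmul a b;
  cstarK : involutive cstar;
  cstarD : {morph cstar : a b / a + b};
  cstarZ : forall (k : R[i]) a, cstar (k *: a) = k^* *: cstar a;
  cstarM : forall a b, cstar (cmul a b) = cmul (cstar b) (cstar a);
  ler_norm_cmul : forall a b, `|cmul a b| <= `|a| * `|b|;
  norm_cstar_cmul : forall a, `|cmul (cstar a) a| = `|a| ^+ 2
}.

#[short(type="cstarAlgType")]
HB.structure Definition CstarAlgebra (R : realType) :=
  {A of CompleteNormedModule_isCstarAlgebra R A & CompleteNormedModule R[i] A}.

Definition cpositive (R : realType) (A : cstarAlgType R) (a : A) : Prop :=
  exists b : A, a = cmul (cstar b) b.

(* Right modules; the inner product is conjugate linear in its first variable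
   and linear in its second one.  The norm of H is the one induced by the inner
   product, so that inner x x = 0 implies x = 0 and H is complete for it. *)
HB.mixin Record CompleteNormedModule_isHilbert (R : realType)
    (A : cstarAlgType R) (H : Type) of CompleteNormedModule R[i] H := {
  ract : H -> A -> H;
  inner : H -> H -> A;
  ractDl : forall x y a, ract (x + y) a = ract x a + ract y a;
  ractDr : forall x a b, ract x (a + b) = ract x a + ract x b;
  ractA : forall x a b, ract (ract x a) b = ract x (cmul a b);
  ractZl : forall (k : R[i]) x a, ract (k *: x) a = k *: ract x a;
  ractZr : forall (k : R[i]) x a, ract x (k *: a) = k *: ract x a;
  innerDr : forall x y z, inner x (y + z) = inner x y + inner x z;
  innerZr : forall (k : R[i]) x y, inner x (k *: y) = k *: inner x y;
  inner_ractr : forall x y a, inner x (ract y a) = cmul (inner x y) a;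
  inner_star : forall x y, cstar (inner x y) = inner y x;
  inner_positive : forall x, cpositive (inner x x);
  norm_inner : forall x, `|x| ^+ 2 = `|inner x x|
}.

#[short(type="hilbertModType")]
HB.structure Definition HilbertModule (R : realType) (A : cstarAlgType R) :=
  {H of CompleteNormedModule_isHilbert R A H & CompleteNormedModule R[i] H}.

Section InnerTheory.
Context (R : realType) (A : cstarAlgType R) (H : hilbertModType A).
Implicit Types x y z : H.

Lemma innerDl x y z : inner (x + y) z = inner x z + inner y z :> A.
Proof. by rewrite -inner_star innerDr cstarD !inner_star. Qed.

Lemma innerZl (k : R[i]) x y : inner (k *: x) y = k^* *: inner x y :> A.
Proof. by rewrite -inner_star innerZr cstarZ !inner_star. Qed.

Lemma innerNr x y : inner x (- y) = - inner x y :> A.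
Proof. by rewrite -scaleN1r innerZr scaleN1r. Qed.

Lemma innerNl x y : inner (- x) y = - inner x y :> A.
Proof. by rewrite -inner_star innerNr -scaleN1r cstarZ rmorphN1 scaleN1r inner_star. Qed.

Lemma inner0r x : inner x 0 = 0 :> A.
Proof. by rewrite -(scale0r (0 : H)) innerZr scale0r. Qed.

Lemma inner0l x : inner 0 x = 0 :> A.
Proof. by rewrite -(scale0r (0 : H)) innerZl rmorph0 scale0r. Qed.

Lemma inner_eq0 x : inner x x = 0 :> A -> x = 0.
Proof.
by move=> xx0; apply/eqP; rewrite -normr_eq0 -sqrf_eq0 norm_inner xx0 normr0.
Qed.

Lemma inner_injl x y : (forall z, inner x z = inner y z :> A) -> x = y.
Proof.
move=> xy; apply/eqP; rewrite -subr_eq0; apply/eqP/inner_eq0.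
by rewrite innerDl innerNl xy subrr.
Qed.

Lemma inner_injr x y : (forall z, inner z x = inner z y :> A) -> x = y.
Proof. by move=> xy; apply: inner_injl => z; rewrite -inner_star xy inner_star. Qed.

End InnerTheory.

(* The adjoint is unique, hence carrying it as data adds nothing to its
   existence: see adjointable_ext. Linearity and boundedness are automatic. *)
Record adjointable (R : realType) (A : cstarAlgType R) (H K : hilbertModType A)
    := Adjointable {
  adj_fun :> H -> K;
  adj_star : K -> H;
  adj_starP : forall x y, inner (adj_fun x) y = inner x (adj_star y) :> A
}.

Notation "''L' ( H , K )" := (adjointable H K) (format "''L' ( H ,  K )").
Notation "''L' ( H )" := (adjointable H H) (format "''L' ( H )").

Section AdjointableOperations.
Context (R : realType) (A : cstarAlgType R).
Implicit Types H K L : hilbertModType A.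

Lemma adjointable_ext H K (S T : 'L(H, K)) : (forall x, S x = T x) -> S = T.
Proof.
case: S => f fs fP; case: T => g gs gP /= /funext fg; subst g.
suff fsgs : fs = gs by subst gs; congr Adjointable; exact: Prop_irrelevance.
by apply: funext => y; apply: inner_injr => x; rewrite -fP gP.
Qed.

Lemma adjoint_starP H K (T : 'L(H, K)) y x :
  inner (adj_star T y) x = inner y (T x) :> A.
Proof. by rewrite -inner_star -adj_starP inner_star. Qed.

Definition adjoint H K (T : 'L(H, K)) : 'L(K, H) :=
  Adjointable (adjoint_starP T).

Fact adj_id_subproof H (x y : H) : inner (idfun x) y = inner x (idfun y) :> A.
Proof. by []. Qed.

Definition adj_id H : 'L(H) := Adjointable (@adj_id_subproof H).

Fact adj_comp_subproof H K L (S : 'L(K, L)) (T : 'L(H, K)) x y :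
  inner ((S \o T) x) y = inner x ((adj_star T \o adj_star S) y) :> A.
Proof. by rewrite /= !adj_starP. Qed.

Definition adj_comp H K L (S : 'L(K, L)) (T : 'L(H, K)) : 'L(H, L) :=
  Adjointable (adj_comp_subproof S T).

Fact adj_zero_subproof H K (x : H) (y : K) : inner (0 : K) y = inner x (0 : H) :> A.
Proof. by rewrite inner0l inner0r. Qed.

Definition adj_zero H K : 'L(H, K) :=
  @Adjointable _ _ H K (fun=> 0) (fun=> 0) (@adj_zero_subproof H K).

Fact adj_opp_subproof H K (T : 'L(H, K)) x y :
  inner (- T x) y = inner x (- adj_star T y) :> A.
Proof. by rewrite innerNl innerNr adj_starP. Qed.

Definition adj_opp H K (T : 'L(H, K)) : 'L(H, K) :=
  Adjointable (adj_opp_subproof T).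

Fact adj_add_subproof H K (S T : 'L(H, K)) x y :
  inner (S x + T x) y = inner x (adj_star S y + adj_star T y) :> A.
Proof. by rewrite innerDl innerDr !adj_starP. Qed.

Definition adj_add H K (S T : 'L(H, K)) : 'L(H, K) :=
  Adjointable (adj_add_subproof S T).

Context (H K : hilbertModType A).

Fact adj_addA : associative (@adj_add H K).
Proof. by move=> S T U; apply: adjointable_ext => x /=; rewrite addrA. Qed.

Fact adj_addC : commutative (@adj_add H K).
Proof. by move=> S T; apply: adjointable_ext => x /=; rewrite addrC. Qed.

Fact adj_add0 : left_id (@adj_zero H K) (@adj_add H K).
Proof. by move=> T; apply: adjointable_ext => x /=; rewrite add0r. Qed.

Fact adj_addN : left_inverse (@adj_zero H K) (@adj_opp H K) (@adj_add H K).
Proof. by move=> T; apply: adjointable_ext => x /=; rewrite addNr. Qed.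

HB.instance Definition _ := gen_eqMixin 'L(H, K).
HB.instance Definition _ := gen_choiceMixin 'L(H, K).
HB.instance Definition _ :=
  GRing.isZmodule.Build 'L(H, K) adj_addA adj_addC adj_add0 adj_addN.

End AdjointableOperations.

Notation "S \oL T" := (adj_comp S T)
  (at level 40, left associativity) : ring_scope.

(* The values of `| | are real elements of R[i], whence the real part. The
   extended real supremum is finite, because adjointable operators are bounded;
   it spares the default value that the supremum in R takes on unbounded sets. *)
Definition opnorm (R : realType) (A : cstarAlgType R) (H K : hilbertModType A)
    (T : 'L(H, K)) : \bar R :=
  ereal_sup [set (complex.Re `|T x|)%:E | x in [set x : H | `|x| <= 1]].

Section WeightedMoorePenrose.
Context (R : realType) (A : cstarAlgType R).
Implicit Types H K L : hilbertModType A.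

Definition selfadjoint H (T : 'L(H)) : Prop := adjoint T = T.

Definition invertible H (T : 'L(H)) : Prop :=
  exists S : 'L(H), T \oL S = adj_id H /\ S \oL T = adj_id H.

Definition weight H (M : 'L(H)) : Prop := selfadjoint M /\ invertible M.

Definition is_wMP H K (M : 'L(K)) (N : 'L(H)) (T : 'L(H, K)) (X : 'L(K, H)) :
    Prop :=
  [/\ T \oL X \oL T = T, X \oL T \oL X = X,
      selfadjoint (M \oL T \oL X) & selfadjoint (N \oL X \oL T)].

Definition wMP_exists H K (M : 'L(K)) (N : 'L(H)) (T : 'L(H, K)) : Prop :=
  [/\ weight M, weight N & exists X : 'L(K, H), is_wMP M N T X].

(* Only meaningful when wMP_exists M N T holds. *)
Definition wMP H K (M : 'L(K)) (N : 'L(H)) (T : 'L(H, K)) : 'L(K, H) :=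
  xget 0 [set X | is_wMP M N T X].

Lemma adj_compA H1 H2 H3 H4 (S : 'L(H3, H4)) (T : 'L(H2, H3)) (U : 'L(H1, H2)) :
  S \oL (T \oL U) = S \oL T \oL U.
Proof. exact: adjointable_ext. Qed.

Lemma adj_comp1l H K (T : 'L(H, K)) : adj_id K \oL T = T.
Proof. exact: adjointable_ext. Qed.

Lemma adjoint_comp H K L (S : 'L(K, L)) (T : 'L(H, K)) :
  adjoint (S \oL T) = adjoint T \oL adjoint S.
Proof. exact: adjointable_ext. Qed.

Lemma invertible_compI H K (M : 'L(K)) (S T : 'L(H, K)) :
  invertible M -> M \oL S = M \oL T -> S = T.
Proof.
move=> [W [_ WM]] /(congr1 (adj_comp W)).
by rewrite !adj_compA WM !adj_comp1l.
Qed.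

Lemma selfadjoint_compE H (M E : 'L(H)) :
  selfadjoint M -> selfadjoint (M \oL E) -> adjoint E \oL M = M \oL E.
Proof. by move=> sM sME; rewrite -{1}sM -adjoint_comp sME. Qed.

Lemma is_wMP_uniq H K (M : 'L(K)) (N : 'L(H)) (T : 'L(H, K)) (X Y : 'L(K, H)) :
  weight M -> weight N -> is_wMP M N T X -> is_wMP M N T Y -> X = Y.
Proof.
move=> [sM iM] [sN iN] [TX XT MX NX] [TY YT MY NY].
rewrite -!adj_compA in MX MY NX NY.
have {}MX := selfadjoint_compE sM MX; have {}MY := selfadjoint_compE sM MY.
have {}NX := selfadjoint_compE sN NX; have {}NY := selfadjoint_compE sN NY.
have TXY : T \oL X = T \oL Y.
  apply: (invertible_compI iM); rewrite -{1}TY -(adj_compA _ T X) adj_compA -MY.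
  by rewrite -adj_compA -MX adj_compA -adjoint_comp adj_compA TX MY.
have XTY : X \oL T = Y \oL T.
  apply: (invertible_compI iN); rewrite -{1}TY -(adj_compA T Y T) 2!adj_compA.
  rewrite -(adj_compA N) -NX -adj_compA -NY adj_compA -adjoint_comp.
  by rewrite -adj_compA (adj_compA T) TX NY.
by rewrite -XT XTY -adj_compA TXY adj_compA.
Qed.

Lemma wMPP H K (M : 'L(K)) (N : 'L(H)) (T : 'L(H, K)) :
  wMP_exists M N T -> is_wMP M N T (wMP M N T).
Proof. by move=> [_ _ [X XP]]; exact: (xgetPex 0 (ex_intro _ X XP)). Qed.

End WeightedMoorePenrose.

(* Main.v *)
Require Import Defs.
From mathcomp Require Import all_boot all_order all_algebra.
From mathcomp Require Import all_classical all_reals all_analysis.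
From mathcomp Require Import ring lra.
From HB Require Import structures.

(* With [P = T X] and [Q = X T], the idempotents [P_n] with the range of [P] and
   [Q_n] with the kernel of [Q] that are self-adjoint for the perturbed weights
   give the perturbed inverse as [Q_n X P_n]. They are explicit expressions in
   inverses of self-adjoint operators close to an invertible one, so everything
   reduces to the continuity of inversion.

   Adjointable operators must be shown to be bounded on the way. Polarization
   gives a Cauchy-Schwarz inequality with constant 4, which suffices for this
   and avoids the order theory of C*-algebras; and since only self-adjoint
   operators are inverted, an inverse as a function is its own adjoint. *)

Set Implicit Arguments.
Unset Strict Implicit.
Unset Printing Implicit Defensive.

Import Order.TTheory GRing.Theory Num.Theory.
Import numFieldNormedType.Exports.
Local Open Scope classical_set_scope.
Local Open Scope ring_scope.
Local Open Scope complex_scope.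

(** Norms over [R[i]] lie in [R[i]], which is only partially ordered; taking real parts moves all
    estimates to the ordered field [R]. *)
Definition rnorm (R : realType) (V : normedModType R[i]) (x : V) : R :=
  complex.Re `|x|.

(** * The norm as a real number *)

Section RealNorm.
Context (R : realType) (V : normedModType R[i]).
Implicit Types x y : V.

Lemma rnormE x : (rnorm x)%:C = `|x|.
Proof. by rewrite /rnorm RRe_real// normr_real. Qed.

Lemma le_rnorm x (c : R) : (rnorm x <= c) = (`|x| <= c%:C).
Proof. by rewrite -rnormE lecR. Qed.

Lemma rnorm_ge0 x : 0 <= rnorm x.
Proof. by rewrite -ler0c rnormE. Qed.

Lemma rnorm0 : rnorm (0 : V) = 0.
Proof. by rewrite /rnorm normr0. Qed.

Lemma rnorm0_eq0 x : rnorm x = 0 -> x = 0.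
Proof. by move=> x0; apply/eqP; rewrite -normr_eq0 -rnormE x0. Qed.

Lemma rnormN x : rnorm (- x) = rnorm x.
Proof. by rewrite /rnorm normrN. Qed.

Lemma rdistC x y : rnorm (x - y) = rnorm (y - x).
Proof. by rewrite -rnormN opprB. Qed.

Lemma ler_rnormD x y : rnorm (x + y) <= rnorm x + rnorm y.
Proof. by rewrite le_rnorm rmorphD/= !rnormE ler_normD. Qed.

Lemma ler_rdistD z x y : rnorm (x - y) <= rnorm (x - z) + rnorm (z - y).
Proof. by rewrite (le_trans _ (ler_rnormD _ _))// addrA subrK. Qed.

Lemma rnormZ (c : R) x : rnorm (c%:C *: x) = `|c| * rnorm x.
Proof.
apply: complexI; rewrite rnormE normrZ rmorphM/= rnormE; congr (_ * _).
by rewrite normc_def /= expr0n addr0 sqrtr_sqr.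
Qed.

Lemma rnormi x : rnorm ('i *: x) = rnorm x.
Proof.
rewrite /rnorm normrZ.
have -> : `|'i : R[i]| = 1 by rewrite normc_def/= expr0n add0r expr1n sqrtr1.
by rewrite mul1r.
Qed.

Lemma rnormMn x n : rnorm (x *+ n) = rnorm x *+ n.
Proof.
rewrite -scaler_nat -(rmorph_nat (real_complex R)) rnormZ.
by rewrite normr_nat mulr_natl.
Qed.

Lemma rnorm_polar x : exists2 u, rnorm u <= 1 & x = (rnorm x)%:C *: u.
Proof.
have [x0|x0] := eqVneq (rnorm x) 0.
  by exists 0; rewrite ?rnorm0// scaler0 (rnorm0_eq0 x0).
exists ((rnorm x)^-1%:C *: x); last first.
  by rewrite scalerA -rmorphM/= divff// scale1r.
by rewrite rnormZ ger0_norm ?invr_ge0 ?rnorm_ge0// mulVf.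
Qed.

End RealNorm.

(** The steps telescope to [b k - b (k + m)], so [b] is nonincreasing with limit [0] and [u] is
    Cauchy. With geometric [b], this serves both the gliding hump and the fixed point iteration. *)
Lemma cvg_dominated_steps (R : realType) (V : completeNormedModType R[i])
    (u : nat -> V) (b : nat -> R) :
  (forall k, rnorm (u k.+1 - u k) <= b k - b k.+1) ->
  b @ \oo --> 0 ->
  exists l, forall k, rnorm (u k - l) <= b k.
Proof.
move=> ub b0.
have ubm k m : rnorm (u (k + m)%N - u k) <= b k - b (k + m)%N.
  elim: m => [|m IH]; first by rewrite addn0 !subrr rnorm0.
  rewrite addnS (le_trans (ler_rdistD (u (k + m)%N) _ _))//.
  by move: (ub (k + m)%N); lra.
have b_ge0 k : 0 <= b k.
  apply: (cvgr_to_le b0); near=> m.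
  have km : (k <= m)%N by near: m; exact: nbhs_infty_ge.
  have := ubm k (m - k)%N; rewrite subnKC// => /(le_trans (rnorm_ge0 _)).
  by rewrite subr_ge0.
have ukm k m : (k <= m)%N -> rnorm (u k - u m) <= b k.
  move=> km; rewrite rdistC -(subnKC km) (le_trans (ubm _ _))//.
  by rewrite gerBl.
have : cvg (u @ \oo).
  apply: cauchy_cvg; apply: cauchy_exP => e e0.
  have re0 : 0 < complex.Re e by move: e0; rewrite ltcE => /andP[].
  have [k _ /(_ _ (leqnn k)) bke] := cvgr_lt _ b0 _ re0.
  exists (u k); exists k => // m km; rewrite /= -ball_normE /=.
  have -> : e = (complex.Re e)%:C.
    by rewrite RRe_real// gtr0_real.
  by rewrite -rnormE ltcR (le_lt_trans (ukm _ _ km)).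
move=> /cvg_ex[l ul]; exists l => k.
apply/ler_addgt0Pl => e e0.
have e0C : 0 < e%:C by rewrite ltcR.
near \oo => m.
rewrite (le_trans (ler_rdistD (u m) _ _))// addrC lerD//.
  rewrite le_rnorm distrC ltW//.
  by near: m; move/cvgrPdist_lt : ul; exact.
by apply: ukm; near: m; exact: nbhs_infty_ge.
Unshelve. all: by end_near. Qed.

(** * Cauchy-Schwarz by polarization *)

Section CauchySchwarz.
Context (R : realType) (A : cstarAlgType R) (H : hilbertModType A).
Implicit Types x y : H.

Lemma inner_parallelogram x y :
  inner (x + y) (x + y) - inner (x - y) (x - y)
  = (inner x y + inner y x) *+ 2 :> A.
Proof.
rewrite !innerDl !innerDr !innerNl !innerNr opprK.
set a := inner x x; set b := inner x y; set c := inner y x; set d := inner y y.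
rewrite mulr2n !opprD !opprK [a + b]addrC [c + d]addrC -!addrA; congr (b + _).
rewrite [d + _]addrC !addrA [a + c]addrC -!addrA; congr (c + _).
by rewrite addNr addr0 addrA subrr add0r.
Qed.

(** The first difference is [(inner x y + inner y x) *+ 2], and the term in ['i] contributes
    [(inner x y - inner y x) *+ 2]. *)
Lemma inner_polarization x y :
  inner x y *+ 4 =
  inner (x + y) (x + y) - inner (x - y) (x - y)
  - 'i *: (inner (x + 'i *: y) (x + 'i *: y)
           - inner (x - 'i *: y) (x - 'i *: y)) :> A.
Proof.
rewrite !inner_parallelogram innerZl innerZr -scalerMnr scalerDr !scalerA.
have -> : 'i * 'i = -1 :> R[i] by rewrite -expr2 sqr_i.
have -> : 'i * 'i^* = 1 :> R[i] by simpc.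
rewrite scaleN1r scale1r -mulrnBl opprD opprK addrACA subrr addr0.
by rewrite -mulr2n -mulrnA.
Qed.

Lemma rnorm_inner x : rnorm (inner x x : A) = rnorm x ^+ 2.
Proof. by apply: complexI; rewrite rnormE -norm_inner rmorphXn/= rnormE. Qed.

(* Polarization gives the Cauchy-Schwarz inequality up to a constant without
   any positivity argument in the C*-algebra. *)
Lemma rnorm_inner_le x y : rnorm (inner x y : A) <= 4 * (rnorm x * rnorm y).
Proof.
(* Each of the four squares in the polarization is at most [(1 + 1) ^+ 2 = 4], so [inner u v *+ 4]
   has norm at most [16]. *)
have bound (u v : H) : rnorm u <= 1 -> rnorm v <= 1 -> rnorm (inner u v : A) <= 4.
  move=> u1 v1.
  have sq (w : H) : rnorm w <= 1 -> rnorm (inner (u + w) (u + w) : A) <= 4.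
    move=> w1; rewrite rnorm_inner.
    by move: (ler_rnormD u w) (rnorm_ge0 (u + w)); nra.
  have N1 : rnorm (- v) <= 1 by rewrite rnormN.
  have i1 : rnorm ('i *: v) <= 1 by rewrite rnormi.
  have Ni1 : rnorm (- ('i *: v)) <= 1 by rewrite rnormN.
  rewrite -(@ler_pMn2r _ 4)// -rnormMn inner_polarization.
  rewrite (le_trans (ler_rnormD _ _))// rnormN rnormi.
  move: (ler_rnormD (inner (u + v) (u + v) : A) (- inner (u - v) (u - v))).
  move: (ler_rnormD (inner (u + 'i *: v) (u + 'i *: v) : A)
           (- inner (u - 'i *: v) (u - 'i *: v))).
  rewrite !rnormN; move: (sq _ v1) (sq _ N1) (sq _ i1) (sq _ Ni1).
  lra.
have [u u1 xu] := rnorm_polar x; have [v v1 yv] := rnorm_polar y.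
rewrite [in leLHS]xu [in leLHS]yv innerZl innerZr -[Num.conj _]/(conjc _).
rewrite conjc_real !rnormZ !ger0_norm ?rnorm_ge0// mulrA mulrC.
by rewrite ler_wpM2r ?bound// mulr_ge0 ?rnorm_ge0.
Qed.

End CauchySchwarz.

(** * Automatic linearity and boundedness of adjointable operators *)

Section AdjointableLinear.
Context (R : realType) (A : cstarAlgType R) (H K : hilbertModType A).
Implicit Type T : 'L(H, K).

Fact adj_fun_is_linear T : linear T.
Proof.
move=> k x y; apply: (@inner_injr _ A) => z.
by rewrite -adjoint_starP innerDr innerZr innerDr innerZr !adjoint_starP.
Qed.

HB.instance Definition _ T :=
  GRing.isLinear.Build R[i] H K _ T (@adj_fun_is_linear T).

(* Uniform boundedness by a gliding hump: if [T] were unbounded, the functionals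
   [inner (T (x n))] with [x n] in the unit ball would be unbounded at some [l],
   while they are bounded at [l] by a multiple of the norm of [adj_star T l]. *)
Lemma adjointable_bounded T :
  exists2 c : R, 0 <= c & forall x, rnorm (T x) <= c * rnorm x.
Proof.
apply: contrapT => unb.
have /choice[x_ xP] : forall n : nat, exists x,
    rnorm x <= 1 /\ n%:R * 8 ^+ n.+1 < rnorm (T x).
  move=> n; apply: contrapT => nx; apply: unb.
  exists (n%:R * 8 ^+ n.+1); first by rewrite mulr_ge0// exprn_ge0.
  move=> x; have [u u1 xu] := rnorm_polar x.
  rewrite [X in T X]xu linearZ/= rnormZ ger0_norm ?rnorm_ge0// mulrC.
  rewrite ler_wpM2r ?rnorm_ge0// leNgt; apply/negP => Tu.
  by apply: nx; exists u.
(* The humps after the [n]-th sum to at most [q ^+ n.+1 / 7]; with the Cauchy-Schwarz constant they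
   cost at most [4 / 7] of what the [n]-th hump gains. *)
pose q : R := 8^-1.
pose t n := T (x_ n).
have t0 n : 0 < rnorm (t n).
  by rewrite (le_lt_trans _ (xP n).2)// mulr_ge0// exprn_ge0.
pose h n : K := (q ^+ n.+1 / rnorm (t n))%:C *: t n.
have q0 n : 0 < q ^+ n by rewrite exprn_gt0 ?invr_gt0.
have hE n : rnorm (h n) = q ^+ n.+1.
  rewrite rnormZ ger0_norm; last by rewrite ltW// divr_gt0.
  by rewrite divfK// gt_eqF.
have thE n : rnorm (inner (t n) (h n) : A) = q ^+ n.+1 * rnorm (t n).
  rewrite innerZr rnormZ rnorm_inner ger0_norm; last by rewrite ltW// divr_gt0.
  by rewrite expr2 mulrA divfK// gt_eqF.
(* The values at [z + h n] and [z - h n] differ by twice [inner (t n) (h n)], so one of the two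
   signs reaches the bound. *)
have /choice[step stepP] : forall nz : nat * K, exists z',
    rnorm (z' - nz.2) <= q ^+ nz.1.+1 /\
    q ^+ nz.1.+1 * rnorm (t nz.1) <= rnorm (inner (t nz.1) z' : A).
  move=> [n z] /=.
  have [le|gt] := lerP (q ^+ n.+1 * rnorm (t n))
                       (rnorm (inner (t n) (z + h n) : A)).
    by exists (z + h n); rewrite [z + _ in X in X <= _]addrC addrK hE.
  exists (z - h n); rewrite [z - _ in X in X <= _]addrC addrK rnormN hE.
  split=> //.
  have := ler_rnormD (inner (t n) (z + h n) : A) (- inner (t n) (z - h n)).
  rewrite rnormN -innerNr -innerDr opprB [z + h n]addrC addrACA subrr addr0 -mulr2n.
  rewrite -scaler_nat innerZr scaler_nat rnormMn thE.
  by rewrite [h n + z]addrC; move: gt; lra.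
pose fix y n : K := if n is m.+1 then step (m, y m) else 0.
have [k||l yl] := @cvg_dominated_steps _ _ y (fun k => q ^+ k / 7).
- rewrite (le_trans (stepP (k, y k)).1)//= exprS /q; lra.
- rewrite -[X in _ --> X](mul0r 7^-1); apply: cvgMl.
  by apply: cvg_expr; rewrite ger0_norm /q; lra.
pose B := rnorm (adj_star T l).
(* With [a = q ^+ n.+1 * rnorm (t n)], one gets [n < a <= 4 * B + 4 * a / 7], hence
   [a <= 28 / 3 * B]. *)
have nB n : n%:R <= 10 * B.
  have t1 : rnorm (inner (t n) l : A) <= 4 * B.
    rewrite adj_starP (le_trans (rnorm_inner_le _ _))//.
    rewrite ler_wpM2l// ler_piMl ?rnorm_ge0//; exact: (xP n).1.
  have t2 := rnorm_inner_le (t n) (y n.+1 - l).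
  have := ler_rnormD (inner (t n) l : A) (inner (t n) (y n.+1 - l)).
  rewrite -innerDr addrC subrK => t3.
  have t4 := (stepP (n, y n)).2.
  have t5 : n%:R < q ^+ n.+1 * rnorm (t n).
    by rewrite mulrC exprVn ltr_pdivlMr ?exprn_gt0//; exact: (xP n).2.
  have t6 : rnorm (t n) * rnorm (y n.+1 - l) <= q ^+ n.+1 * rnorm (t n) / 7.
    rewrite [q ^+ _ * _]mulrC -mulrA ler_wpM2l ?rnorm_ge0//; exact: yl.
  move: t1 t2 t3 t4 t5 t6 => /=; have := rnorm_ge0 (adj_star T l); rewrite -/B; lra.
by have := nB (Num.truncn (10 * B)).+1; rewrite leNgt truncnS_gt.
Qed.

End AdjointableLinear.

(** * Convergence in operator norm *)

Section OperatorNorm.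
Context (R : realType) (A : cstarAlgType R) (H K : hilbertModType A).
Implicit Type T : 'L(H, K).

Lemma opnorm_ge0 T : (0 <= opnorm T)%E.
Proof.
apply: ereal_sup_ubound; exists 0; first by rewrite /= normr0 ler01.
by rewrite linear0 normr0.
Qed.

Lemma opnorm_le T (c : R) :
  0 <= c -> (opnorm T <= c%:E)%E <-> forall x, rnorm (T x) <= c * rnorm x.
Proof.
move=> c0; split=> [Tc x|Tc].
  have [u u1 xu] := rnorm_polar x.
  rewrite [X in T X]xu linearZ/= rnormZ ger0_norm ?rnorm_ge0// mulrC.
  rewrite ler_wpM2r ?rnorm_ge0// -lee_fin (le_trans _ Tc)//.
  by apply: ereal_sup_ubound; exists u => //=; rewrite -le_rnorm.
apply: ge_ereal_sup => _ [x /= x1 <-]; rewrite lee_fin (le_trans (Tc x))//.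
by rewrite ler_piMr// le_rnorm.
Qed.

(** Norm convergence through bounds with real constants, which avoids extended reals; [opcvgP] links
    it to [opnorm]. *)
Definition opcvg (T_ : nat -> 'L(H, K)) T : Prop :=
  forall e : R, 0 < e ->
  \forall n \near \oo, forall x, rnorm (T_ n x - T x) <= e * rnorm x.

Lemma opcvgP (T_ : nat -> 'L(H, K)) T :
  opcvg T_ T <-> opnorm (T_ n - T) @[n --> \oo] --> 0%E.
Proof.
split=> [TT|/fine_cvgP[Tfin /cvgr0Pnorm_le T0] e e0].
  have TT' (e : R) : 0 < e -> \forall n \near \oo, (opnorm (T_ n - T)%R <= e%:E)%E.
    move=> e0; apply: filterS (TT _ e0) => n Tn.
    by apply/opnorm_le; rewrite ?ltW.
  apply/fine_cvgP; split.
    apply: filterS (TT' 1 ltr01) => n T1.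
    by rewrite ge0_fin_numE ?opnorm_ge0// (le_lt_trans T1)// ltry.
  apply/cvgr0Pnorm_le => e e0; apply: filterS (TT' _ e0) => n Te /=.
  rewrite ger0_norm ?fine_ge0 ?opnorm_ge0//.
  by rewrite -lee_fin fineK// ge0_fin_numE ?opnorm_ge0// (le_lt_trans Te)// ltry.
apply: filterS2 Tfin (T0 _ e0) => n Tn; rewrite ger0_norm ?fine_ge0 ?opnorm_ge0//.
by rewrite -lee_fin fineK// => /opnorm_le-/(_ (ltW e0)).
Qed.

Lemma opcvg_cst T : opcvg (fun=> T) T.
Proof.
move=> e e0; near=> n => x.
by rewrite subrr rnorm0 mulr_ge0 ?rnorm_ge0// ltW.
Unshelve. all: by end_near. Qed.

Lemma opcvgD (S_ T_ : nat -> 'L(H, K)) S T :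
  opcvg S_ S -> opcvg T_ T -> opcvg (fun n => S_ n + T_ n) (S + T).
Proof.
move=> SS TT e e0; have e20 : 0 < e / 2 by rewrite divr_gt0.
apply: filterS2 (SS _ e20) (TT _ e20) => n Sn Tn x.
rewrite /= opprD addrACA (le_trans (ler_rnormD _ _))//.
by move: (Sn x) (Tn x); lra.
Qed.

Lemma opcvgN (T_ : nat -> 'L(H, K)) T :
  opcvg T_ T -> opcvg (fun n => - T_ n) (- T).
Proof.
move=> TT e e0; apply: filterS (TT _ e0) => n Tn x.
by rewrite /= -opprD rnormN.
Qed.

Lemma opcvgB (S_ T_ : nat -> 'L(H, K)) S T :
  opcvg S_ S -> opcvg T_ T -> opcvg (fun n => S_ n - T_ n) (S - T).
Proof. by move=> SS TT; apply/opcvgD/opcvgN. Qed.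

End OperatorNorm.

Lemma opcvg_comp (R : realType) (A : cstarAlgType R) (H K L : hilbertModType A)
    (S_ : nat -> 'L(K, L)) (T_ : nat -> 'L(H, K)) (S : 'L(K, L)) (T : 'L(H, K)) :
  opcvg S_ S -> opcvg T_ T -> opcvg (fun n => S_ n \oL T_ n) (S \oL T).
Proof.
move=> SS TT e e0.
have [s s0 sP] := adjointable_bounded S; have [t t0 tP] := adjointable_bounded T.
have d0 : 0 < 1 + s + t by lra.
(* With errors [E] and [F] of size [d] on [S] and [T], the composite error [E T + E F + S F] is at
   most [d * t + d * d + s * d], and [d <= 1] bounds this by [d * (1 + s + t)]. *)
pose d := Num.min 1 (e / (1 + s + t)).
have dgt0 : 0 < d by rewrite lt_min ltr01 divr_gt0.
apply: filterS2 (SS _ dgt0) (TT _ dgt0) => n Sn Tn x.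
have d1 : d <= 1 by rewrite ge_min lexx.
have de : d * (1 + s + t) <= e.
  by rewrite -ler_pdivlMr// ge_min lexx orbT.
have -> : (S_ n \oL T_ n) x - (S \oL T) x =
    (S_ n (T x) - S (T x)) + (S_ n (T_ n x - T x) - S (T_ n x - T x))
    + S (T_ n x - T x).
  by rewrite -addrA subrK linearB/= addrC addrA subrK.
rewrite (le_trans (ler_rnormD _ _))//.
move: (ler_rnormD (S_ n (T x) - S (T x))
         (S_ n (T_ n x - T x) - S (T_ n x - T x))).
move: (Sn (T x)) (Sn (T_ n x - T x)) (sP (T_ n x - T x)) (Tn x) (tP x).
move: (rnorm_ge0 x) (rnorm_ge0 (T_ n x - T x)) (rnorm_ge0 (T x)).
set a := rnorm x; set b := rnorm (T_ n x - T x); set c := rnorm (T x).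
move=> a0 b0 c0 h1 h2 h3 h4 h5 h6.
have : d * c <= d * t * a by rewrite -mulrA ler_wpM2l// ltW.
have : d * b <= b by rewrite ler_piMl.
have : s * b <= s * d * a by rewrite -mulrA ler_wpM2l.
have : d * (1 + s + t) * a <= e * a by rewrite ler_wpM2r.
by rewrite (_ : d * (1 + s + t) * a = d * a + s * d * a + d * t * a); [lra|ring].
Qed.

(** With [E = V - W], the equation [V x = y] becomes [x = S y - S (E x)], whose right-hand side
    contracts by [s * e <= 2^-1]. The final estimate is [U - S = - S E U] with [U] bounded by
    [2 * s]. Self-adjointness of [V] makes its inverse its own adjoint. *)
Lemma invertible_perturbation (R : realType) (A : cstarAlgType R)
    (H : hilbertModType A) (W S V : 'L(H)) (s e : R) :
  W \oL S = adj_id H -> S \oL W = adj_id H -> selfadjoint V ->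
  (forall x, rnorm (S x) <= s * rnorm x) -> 0 <= s -> 0 <= e ->
  (forall x, rnorm (V x - W x) <= e * rnorm x) -> s * e <= 2^-1 ->
  exists U : 'L(H), [/\ V \oL U = adj_id H, U \oL V = adj_id H &
    forall x, rnorm (U x - S x) <= 2 * s ^+ 2 * e * rnorm x].
Proof.
move=> WS SW sV sP s0 e0 eP se.
have {}WS x : W (S x) = x by rewrite -[LHS]/((W \oL S) x) WS.
have {}SW x : S (W x) = x by rewrite -[LHS]/((S \oL W) x) SW.
have [E EE] : exists E : 'L(H), forall x : H, E x = V x - W x by exists (V - W).
have {}eP x : rnorm (E x) <= e * rnorm x by rewrite EE.
have contr x : rnorm (S (E x)) <= rnorm x / 2.
  rewrite (le_trans (sP _))// (le_trans (ler_wpM2l s0 (eP x)))//.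
  by rewrite mulrA mulrC ler_wpM2l ?rnorm_ge0.
(* Absorbing [rnorm x / 2] on the left gives both injectivity and the bound [2 * s] on the
   inverse. *)
have below x : rnorm x <= 2 * s * rnorm (V x).
  have xE : x = S (V x) - S (E x) by rewrite EE -linearB/= opprB addrC subrK SW.
  have := ler_rnormD (S (V x)) (- S (E x)); rewrite -xE rnormN.
  by move: (contr x) (sP (V x)); rewrite -mulrA; lra.
have surj y : exists x, V x = y.
  (* the Banach fixed point iteration for [x = x + S (y - V x)] *)
  pose u := fix u n : H := if n is m.+1 then u m + S (y - V (u m)) else 0.
  have uS n : u n.+1 = S y - S (E (u n)).
    by rewrite EE /= !linearB/= SW opprK addrC -addrA.
  have SEB a b : S y - S (E a) - (S y - S (E b)) = - S (E (a - b)).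
    by rewrite opprB addrC subrKA 2!linearB opprB.
  have u1 n : rnorm (u n.+1 - u n) <= rnorm (S y) / 2 ^+ n.
    elim: n => [|n IH].
      by rewrite /= linear0 !subr0 add0r expr0 divr1.
    have -> : u n.+2 - u n.+1 = - S (E (u n.+1 - u n)).
      by rewrite (uS n.+1) [X in _ - X = _]uS SEB.
    rewrite rnormN (le_trans (contr _))// exprSr invfM mulrA.
    by rewrite ler_wpM2r// invr_ge0.
  have [k||l ul] :=
    @cvg_dominated_steps _ _ u (fun k => 2 * rnorm (S y) * 2^-1 ^+ k).
  - by rewrite (le_trans (u1 k))// exprS -exprVn; lra.
  - by apply: cvg_geometric; rewrite ger0_norm; lra.
  have lE : l = S y - S (E l).
    apply/eqP; rewrite -subr_eq0; apply/eqP/rnorm0_eq0/le_anti.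
    rewrite rnorm_ge0 andbT.
    have cvg0 : (fun k => 4 * rnorm (S y) * 2^-1 ^+ k) @ \oo --> (0 : R).
      by apply: cvg_geometric; rewrite ger0_norm; lra.
    apply: (cvgr_to_ge cvg0); near=> k.
    rewrite (le_trans (ler_rdistD (u k.+1) _ _))//.
    have -> : u k.+1 - (S y - S (E l)) = - S (E (u k - l)).
      by rewrite uS SEB.
    rewrite rnormN rdistC; move: (ul k) (ul k.+1) (contr (u k - l)).
    have := rnorm_ge0 (u k - l); rewrite exprS; lra.
  exists l; apply: (can_inj WS).
  rewrite -[RHS](subrK (S (E l))) -lE EE [X in _ = _ + X]linearB/= SW.
  by rewrite addrC subrK.
have inj x y : V x = V y -> x = y.
  move=> xy; apply/eqP; rewrite -subr_eq0; apply/eqP/rnorm0_eq0/le_anti.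
  rewrite rnorm_ge0 andbT (le_trans (below _))//.
  by rewrite linearB/= xy subrr rnorm0 mulr0.
have /choice[g gP] := surj.
have VP x y : inner (V x) y = inner x (V y) :> A.
  by rewrite adj_starP -[adj_star V]/(adjoint V : H -> H) sV.
have gadj x y : inner (g x) y = inner x (g y) :> A.
  by rewrite -{1}(gP y) -VP gP.
exists (Adjointable gadj); split.
- by apply: adjointable_ext => x /=; rewrite gP.
- by apply: adjointable_ext => x /=; apply: inj; rewrite gP.
move=> x /=.
have -> : g x - S x = - S (E (g x)) by rewrite EE linearB/= SW gP opprB.
rewrite rnormN (le_trans (sP _))//.
have -> : 2 * s ^+ 2 * e * rnorm x = s * (e * (2 * s * rnorm x)) by ring.
rewrite ler_wpM2l// (le_trans (eP _))// ler_wpM2l//.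
by rewrite -{2}(gP x) below.
Unshelve. all: by end_near. Qed.

Lemma adj_comp1r (R : realType) (A : cstarAlgType R) (H K : hilbertModType A)
    (T : 'L(H, K)) : T \oL adj_id H = T.
Proof. exact: adjointable_ext. Qed.

Lemma opcvg_inverse (R : realType) (A : cstarAlgType R) (H : hilbertModType A)
    (W_ : nat -> 'L(H)) (W S : 'L(H)) :
  W \oL S = adj_id H -> S \oL W = adj_id H ->
  (forall n, selfadjoint (W_ n)) -> opcvg W_ W ->
  exists2 S_ : nat -> 'L(H),
    \forall n \near \oo, W_ n \oL S_ n = adj_id H /\ S_ n \oL W_ n = adj_id H &
    opcvg S_ S.
Proof.
move=> WS SW sW WW.
have [s0 s0ge sP0] := adjointable_bounded S.
pose s := s0 + 1; have sgt0 : 0 < s by rewrite /s; lra.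
have sP x : rnorm (S x) <= s * rnorm x.
  by rewrite (le_trans (sP0 x))// ler_wpM2r ?rnorm_ge0// /s; lra.
(* [U] is chosen before [e], so that one sequence serves every precision: an existing inverse is
   unique, and without one no [e] meets the premises, so [0] is a harmless default. *)
have /choice[S_ S_P] : forall n, exists U : 'L(H), forall e, 0 <= e ->
    s * e <= 2^-1 -> (forall x, rnorm (W_ n x - W x) <= e * rnorm x) ->
    [/\ W_ n \oL U = adj_id H, U \oL W_ n = adj_id H &
      forall x, rnorm (U x - S x) <= 2 * s ^+ 2 * e * rnorm x].
  move=> n; have [[U [WU UW]]|nU] := pselect (exists U : 'L(H),
      W_ n \oL U = adj_id H /\ U \oL W_ n = adj_id H).
    exists U => e e0 se eP.
    have [U' [WU' U'W U'P]] :=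
      invertible_perturbation WS SW (sW n) sP (ltW sgt0) e0 eP se.
    split=> //; suff -> : U = U' by [].
    by rewrite -[U]adj_comp1l -U'W -adj_compA WU adj_comp1r.
  exists 0 => e e0 se eP; exfalso; apply: nU.
  have [U' [WU' U'W U'P]] :=
    invertible_perturbation WS SW (sW n) sP (ltW sgt0) e0 eP se.
  by exists U'.
have se : 0 < (2 * s)^-1 by rewrite invr_gt0 mulr_gt0.
have see : s * (2 * s)^-1 <= 2^-1 by rewrite invfM mulrCA divff ?gt_eqF// mulr1.
exists S_.
  by apply: filterS (WW _ se) => n Wn; have [] := S_P n _ (ltW se) see Wn.
move=> e e0.
pose d := Num.min (2 * s)^-1 (e / (2 * s ^+ 2)).
have c0 : 0 < 2 * s ^+ 2 by rewrite mulr_gt0// exprn_gt0.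
have d0 : 0 < d by rewrite lt_min se divr_gt0.
have sd : s * d <= 2^-1 by rewrite (le_trans _ see)// (ler_wpM2l (ltW sgt0))// ge_min lexx.
apply: filterS (WW _ d0) => n Wn x; have [_ _ Sn] := S_P n _ (ltW d0) sd Wn.
rewrite (le_trans (Sn x))// ler_wpM2r ?rnorm_ge0//.
by rewrite mulrC -ler_pdivlMr// ge_min lexx orbT.
Qed.

(** * Algebra of composition and adjoints *)

Section AdjointableAlgebra.
Context (R : realType) (A : cstarAlgType R).

Lemma adj_compDl (H K L : hilbertModType A) (S1 S2 : 'L(K, L)) (T : 'L(H, K)) :
  (S1 + S2) \oL T = S1 \oL T + S2 \oL T.
Proof. exact: adjointable_ext. Qed.

Lemma adj_compBl (H K L : hilbertModType A) (S1 S2 : 'L(K, L)) (T : 'L(H, K)) :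
  (S1 - S2) \oL T = S1 \oL T - S2 \oL T.
Proof. exact: adjointable_ext. Qed.

Lemma adj_compDr (H K L : hilbertModType A) (S : 'L(K, L)) (T1 T2 : 'L(H, K)) :
  S \oL (T1 + T2) = S \oL T1 + S \oL T2.
Proof. by apply: adjointable_ext => x; exact: linearD. Qed.

Lemma adj_compBr (H K L : hilbertModType A) (S : 'L(K, L)) (T1 T2 : 'L(H, K)) :
  S \oL (T1 - T2) = S \oL T1 - S \oL T2.
Proof. by apply: adjointable_ext => x; exact: linearB. Qed.

Lemma adjointK (H K : hilbertModType A) (T : 'L(H, K)) : adjoint (adjoint T) = T.
Proof. exact: adjointable_ext. Qed.

Lemma adjointD (H K : hilbertModType A) (S T : 'L(H, K)) :
  adjoint (S + T) = adjoint S + adjoint T.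
Proof. exact: adjointable_ext. Qed.

Lemma adjointB (H K : hilbertModType A) (S T : 'L(H, K)) :
  adjoint (S - T) = adjoint S - adjoint T.
Proof. exact: adjointable_ext. Qed.

Lemma selfadjoint_inverse (H : hilbertModType A) (V S : 'L(H)) :
  selfadjoint V -> V \oL S = adj_id H -> S \oL V = adj_id H -> selfadjoint S.
Proof.
move=> sV VS SV; rewrite /selfadjoint.
rewrite -[LHS]adj_comp1r -VS adj_compA -[in X in X \oL S]sV -adjoint_comp VS.
by apply: adjointable_ext.
Qed.

End AdjointableAlgebra.

(** * Idempotents adapted to a perturbed weight *)

Section PerturbedProjection.
Context (R : realType) (A : cstarAlgType R) (H : hilbertModType A).
Implicit Types P M : 'L(H).

(* Koliha's formula [P (P + P^# - 1)^-1], with [P^# = M^-1 P^* M], gives the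
   idempotent with the range of [P] whose product with [M] is self-adjoint.
   Multiplying by [M] makes the operator to be inverted self-adjoint, and
   dispenses with the inverse of [M]. *)
Definition proj_pivot P M : 'L(H) := M \oL P + adjoint P \oL M - M.

Lemma selfadjoint_proj_pivot P M : selfadjoint M -> selfadjoint (proj_pivot P M).
Proof.
move=> sM; rewrite /selfadjoint /proj_pivot.
by rewrite adjointB adjointD !adjoint_comp adjointK sM [X in X - _]addrC.
Qed.

(** As [V P] equals [adjoint P M P], it is self-adjoint, which gives [adjoint P V = V P] and then
    [P S = S (adjoint P)]. Moving [P] across [S] yields both claims about [P S M]. *)
Lemma proj_pivot_spec P M S :
  P \oL P = P -> selfadjoint M ->
  proj_pivot P M \oL S = adj_id H -> S \oL proj_pivot P M = adj_id H ->
  P \oL S \oL M \oL P = P /\ selfadjoint (M \oL (P \oL S \oL M)).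
Proof.
move=> PP sM VS SV; set V := proj_pivot P M in VS SV.
have sV : selfadjoint V by exact: selfadjoint_proj_pivot.
have sS : selfadjoint S by exact: selfadjoint_inverse sV VS SV.
have VP : V \oL P = adjoint P \oL M \oL P.
  by rewrite adj_compBl adj_compDl -adj_compA PP addrAC subrr add0r.
have PV : adjoint P \oL V = V \oL P.
  by rewrite -{1}sV -adjoint_comp VP !adjoint_comp adjointK sM adj_compA.
have PS : P \oL S = S \oL adjoint P.
  rewrite -[P in LHS]adj_comp1l -SV -(adj_compA S) -PV -!adj_compA VS.
  by rewrite adj_comp1r.
split.
  by rewrite PS -!adj_compA [_ \oL (M \oL P)]adj_compA -VP adj_compA SV adj_comp1l.
by rewrite /selfadjoint !adjoint_comp sM sS PS -!adj_compA.
Qed.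

(** The first two relations say that [P_ n] is an idempotent with the range of [P]. Since [M P] is
    self-adjoint, the unperturbed pivot is [M (2 P - 1)], and the reflection [2 P - 1] is its own
    inverse. So the pivot has an inverse [S] with [P S M = P], and continuity of inversion
    applies. *)
Lemma opcvg_proj (M_ : nat -> 'L(H)) P M :
  P \oL P = P -> weight M -> selfadjoint (M \oL P) ->
  (forall n, selfadjoint (M_ n)) -> opcvg M_ M ->
  exists2 P_ : nat -> 'L(H),
    \forall n \near \oo, [/\ P \oL P_ n = P_ n, P_ n \oL P = P &
                             selfadjoint (M_ n \oL P_ n)] &
    opcvg P_ P.
Proof.
move=> PP [sM [M' [MM' M'M]]] sMP sM_ MM.
have PM : adjoint P \oL M = M \oL P by exact: selfadjoint_compE.
have VE : proj_pivot P M = M \oL (P + P - adj_id H).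
  by rewrite /proj_pivot PM adj_compBr adj_compDr adj_comp1r.
have reflK : (P + P - adj_id H) \oL (P + P - adj_id H) = adj_id H.
  rewrite adj_compBr adj_comp1r adj_compDr !adj_compBl !adj_compDl PP adj_comp1l.
  by rewrite !addrK opprB addrC subrK.
pose S := (P + P - adj_id H) \oL M'.
have VS : proj_pivot P M \oL S = adj_id H.
  by rewrite VE /S -adj_compA (adj_compA _ _ M') reflK adj_comp1l.
have SV : S \oL proj_pivot P M = adj_id H.
  by rewrite VE /S -adj_compA (adj_compA M') M'M adj_comp1l reflK.
have VV : opcvg (fun n => proj_pivot P (M_ n)) (proj_pivot P M).
  apply: opcvgB => //; apply: opcvgD; apply: opcvg_comp => //; exact: opcvg_cst.
have [S_ S_P SS] :=
  opcvg_inverse VS SV (fun n => selfadjoint_proj_pivot P (sM_ n)) VV.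
exists (fun n => P \oL S_ n \oL M_ n).
  apply: filterS S_P => n [VSn SVn].
  have [] := proj_pivot_spec PP (sM_ n) VSn SVn; split=> //.
  by rewrite !adj_compA PP.
have PSM : P \oL S \oL M = P.
  rewrite /S -!adj_compA M'M adj_comp1r adj_compBr adj_compDr PP adj_comp1r.
  by rewrite addrK.
rewrite -[X in opcvg _ X]PSM; apply: opcvg_comp MM; apply: opcvg_comp SS.
exact: opcvg_cst.
Qed.

End PerturbedProjection.

(** * From adapted idempotents to the weighted inverse *)

Section PerturbedWeights.
Context (R : realType) (A : cstarAlgType R) (H K : hilbertModType A).

(** [P] has the range of [T X] and [Q] the kernel of [X T], so [P T = T] and [T Q = T]. Composing
    the candidate with [T] then gives [P] on one side and [Q] on the other. *)
Lemma is_wMP_proj (T : 'L(H, K)) (X : 'L(K, H)) (P M : 'L(K)) (Q N : 'L(H)) :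
  T \oL X \oL T = T ->
  T \oL X \oL P = P -> P \oL (T \oL X) = T \oL X ->
  X \oL T \oL Q = X \oL T -> Q \oL (X \oL T) = Q ->
  selfadjoint (M \oL P) -> selfadjoint (N \oL Q) ->
  is_wMP M N T (Q \oL X \oL P).
Proof.
move=> TXT XP PX XQ QX sMP sNQ.
have TQ : T \oL Q = T by rewrite -{1}TXT -!adj_compA (adj_compA X) XQ adj_compA.
have PT : P \oL T = T by rewrite -{1}TXT adj_compA PX.
have TY : T \oL (Q \oL X \oL P) = P by rewrite !adj_compA TQ.
have YT : Q \oL X \oL P \oL T = Q by rewrite -adj_compA PT -adj_compA QX.
split.
- by rewrite TY PT.
- rewrite YT !adj_compA; congr (_ \oL X \oL P).
  by rewrite -{1}QX -adj_compA XQ QX.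
- by rewrite -adj_compA TY.
- by rewrite -adj_compA YT.
Qed.

End PerturbedWeights.

Lemma near_weight (R : realType) (A : cstarAlgType R) (H : hilbertModType A)
    (M_ : nat -> 'L(H)) (M : 'L(H)) :
  weight M -> (forall n, selfadjoint (M_ n)) -> opcvg M_ M ->
  \forall n \near \oo, weight (M_ n).
Proof.
move=> [_ [M' [MM' M'M]]] sM_ MM.
have [S_ S_P _] := opcvg_inverse MM' M'M sM_ MM.
by apply: filterS S_P => n Sn; split=> //; exists (S_ n).
Qed.

Theorem theorem5p3 (R : realType) (A : cstarAlgType R) (H K : hilbertModType A)
    (M : 'L(K)) (N : 'L(H)) (T : 'L(H, K)) (M_ : nat -> 'L(K)) (N_ : nat -> 'L(H)) :
  weight M -> weight N -> wMP_exists M N T ->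
  (forall n, selfadjoint (M_ n)) -> (forall n, selfadjoint (N_ n)) ->
  opnorm (M_ n - M) @[n --> \oo] --> 0%E ->
  opnorm (N_ n - N) @[n --> \oo] --> 0%E ->
  (exists n0 : nat, forall n, (n0 <= n)%N -> wMP_exists (M_ n) (N_ n) T) /\
  opnorm (wMP (M_ n) (N_ n) T - wMP M N T) @[n --> \oo] --> 0%E.
Proof.
move=> wM wN exX sM_ sN_ /opcvgP MM /opcvgP NN.
have [TX XT sMX sNX] := wMPP exX; set X := wMP M N T in TX XT sMX sNX *.
have PP : T \oL X \oL (T \oL X) = T \oL X by rewrite adj_compA TX.
rewrite -adj_compA in sMX.
have [P_ P_P PPcvg] := opcvg_proj PP wM sMX sM_ MM.
(* the perturbed idempotent on [H] must keep the kernel of [X \oL T], hence the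
   range of its complement *)
pose F := adj_id H - X \oL T.
have FF : F \oL F = F.
  rewrite /F adj_compBr !adj_compBl !adj_comp1l adj_comp1r adj_compA XT.
  by rewrite subrr subr0.
have sNF : selfadjoint (N \oL F).
  by rewrite /F adj_compBr adj_comp1r /selfadjoint adjointB adj_compA sNX; case: wN => ->.
have [F_ F_P FFcvg] := opcvg_proj FF wN sNF sN_ NN.
(* Eventually [F_ n] has the range of [F], so its complement has the kernel of [X \oL T]. *)
pose Y n := (adj_id H - F_ n) \oL X \oL P_ n.
have YP : \forall n \near \oo, is_wMP (M_ n) (N_ n) T (Y n).
  apply: filterS2 P_P F_P => n [PPn PnP sMPn] [FFn FnF sNFn].
  have XTE : X \oL T = adj_id H - F by rewrite /F opprB addrC subrK.
  apply: is_wMP_proj => //.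
  - by rewrite XTE adj_compBr adj_comp1r adj_compBl adj_comp1l FFn subrr subr0.
  - by rewrite XTE adj_compBr adj_comp1r adj_compBl adj_comp1l FnF subrr subr0.
  - by rewrite adj_compBr adj_comp1r /selfadjoint adjointB sN_ sNFn.
have ex_ : \forall n \near \oo, wMP_exists (M_ n) (N_ n) T.
  apply: filterS3 (near_weight wM sM_ MM) (near_weight wN sN_ NN) YP.
  by move=> n wMn wNn Yn; split=> //; exists (Y n).
split.
  by case: ex_ => n0 _ n0P; exists n0 => n; exact: n0P.
have YX : opcvg Y X.
  (* Writing [X] as [(X T) X (T X)] gives it the shape of [Y n]. *)
  have -> : X = (adj_id H - F) \oL X \oL (T \oL X).
    by rewrite /F opprB addrC subrK !adj_compA !XT.
  by apply: opcvg_comp => //; apply: opcvg_comp (@opcvg_cst _ _ _ _ _);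
     apply: opcvgB => //; exact: opcvg_cst.
(* For small [n], [wMP] may be its default value; from some rank on, uniqueness identifies it with
   [Y n]. *)
apply/opcvgP => e e0; apply: filterS3 YP ex_ (YX _ e0) => n Yn exn Ye.
suff -> : wMP (M_ n) (N_ n) T = Y n by [].
by case: (exn) => wMn wNn _; exact: is_wMP_uniq wMn wNn (wMPP exn) Yn.
Qed.
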